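(* Assume that $g_j$ is affine for $j\in\{1,\dots,\varrho\}$ and $P\subseteq\{x\mid x_i\ge0\text{ for } i\in\{\varrho+1,\dots,n\}\}$. Run the DD algorithm (defined in the context) on $\bar A=\begin{pmatrix}b&-A\end{pmatrix}$ with the modified initialization given in the context, and let $(R^k,\mu^k(1;x))$ be dehomogenized. Let $\bar k$ be the smallest index such that $L^{\bar k}$ is empty. For each $k\in\{\bar k,\dots,m\}$, the following problem is a relaxation of $(\mathrm{AC})$: $$(\mathrm{ACD}^k)\quad\min\ \sum_{i=1}^{p_k} g\!\left(\frac{y\mu^k_i(1;x)}{\mu^k_i(1;x)}\right)R^k_{:,i}\,\mu^k_i(1;x)$$ $$\text{s.t. } y\mu^k_i(1;x)\in\mu^k_i(1;x)C,\quad \mu_i^k(1;x)\ge0\quad(i=1,\dots,p_k),\qquad R^k\mu^k(1;x)=(1;x).$$ Let $\underline{\mathrm{ACD}}^k$ be obtained by replacing $\mu^k(1;x)$ with a variable $\lambda^k\in\mathbb R^{p_k}$ and each $y\mu^k_i(1;x)$ with a variable $y^{k,i}\in\mathbb R^{n_y}$. Then $\underline{\mathrm{ACD}}^k$ is a convex optimization problem that relaxes $(\mathrm{ACD}^k)$, and $$\mathrm{opt}_{\underline{\mathrm{ACD}}^{\bar k}}\le\cdots\le\mathrm{opt}_{\underline{\mathrm{ACD}}^{m}}=\mathrm{opt}_{\mathrm{AC}}.$$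
   Context: Problem: $(\mathrm{AC})$: $\mathrm{opt}_{\mathrm{AC}}=\min\{g_0(y)+\sum_{i=1}^nx_ig_i(y)\mid y\in C,\ x\in P\}$, where $C\subset\mathbb R^{n_y}$ is nonempty compact convex, $P=\{x\in\mathbb R^n\mid Ax\le b\}$ is a nonempty polytope with $A\in\mathbb R^{m\times n}$, and each $g_i:\mathbb R^{n_y}\to\mathbb R$ ($i=0,\dots,n$) is convex. $g(y)=(g_0(y),\dots,g_n(y))$ is regarded as a row vector. Perspective convention: $\lambda g_j(w/\lambda)$ is $0$ when $\lambda=0$, $w=0$; and $0C=\{0\}$. A relaxation of a minimization problem is one in which each feasible point of the original yields a feasible point with objective value no larger. DD algorithm. Input $\bar A\in\mathbb R^{m\times(n+1)}$ with rows $\bar A_{1,:},\dots,\bar A_{m,:}$. Coordinates of $\mathbb R^{n+1}$ are indexed $0,\dots,n$; points are written $(x_0;x)$; $e_0,\dots,e_n$ are the unit vectors. The algorithm produces matrices $R^k$ ($p_k$ columns) and $L^k$ ($q_k$ columns) with $n+1$ rows, and vectors of functions $\mu^k$ (length $p_k$) and $\theta^k$ (length $q_k$) of $(x_0;x)$. Modified initialization: $L^0=(e_1,\dots,e_\varrho)$, $\theta^0=(x_1,\dots,x_\varrho)$, $R^0=(e_0,e_{\varrho+1},\dots,e_n)$, $\mu^0=(x_0,x_{\varrho+1},\dots,x_n)$ (as if $x_i\ge 0$, $i>\varrho$, were already processed). Iteration $k=1,\dots,m$: write $L,\theta,R,\mu,p,q$ for $L^{k-1},\theta^{k-1},R^{k-1},\mu^{k-1},p_{k-1},q_{k-1}$,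 and set $\alpha=\bar A_{k,:}L$, $\beta=\bar A_{k,:}R$. Case 1 ($q>0$ and $\alpha\ne0$): let $\xi=\min\{i\mid\alpha_i\neq0\}$; if $\alpha_\xi<0$ replace (in place) $L_{:,\xi},\theta_\xi,\alpha_\xi$ by their negatives. Set $\mu^k=\bigl(\theta_\xi+\sum_{j=\xi+1}^{q}\alpha_j\theta_j/\alpha_\xi+\sum_{j=1}^{p}\beta_j\mu_j/\alpha_\xi,\ (\mu_j/\alpha_\xi)_{j=1}^{p}\bigr)$, $\theta^k=\bigl((\theta_j)_{j<\xi},(\theta_j/\alpha_\xi)_{j>\xi}\bigr)$, $R^k=\bigl(L_{:,\xi},(\alpha_\xi R_{:,j}-\beta_jL_{:,\xi})_{j=1}^{p}\bigr)$, $L^k=\bigl((L_{:,j})_{j<\xi},(\alpha_\xi L_{:,j}-\alpha_jL_{:,\xi})_{j>\xi}\bigr)$. Case 2 (otherwise): let $N^-,N^0,N^+$ be the sets of $i$ with $\beta_i<0$, $=0$, $>0$, and $N_{\rm tot}=\sum_{i\in N^+}\mu_i\beta_i$. Set $\mu^k=\bigl(\mu_{N^0},(\mu_i+\sum_{j\in N^-}\mu_j\mu_i\beta_j/N_{\rm tot})_{i\in N^+},(\mu_j\mu_i/N_{\rm tot})_{i\in N^+,j\in N^-}\bigr)$, $R^k=\bigl(R_{:,N^0},R_{:,N^+},(\beta_iR_{:,j}-\beta_jR_{:,i})_{i\in N^+,j\in N^-}\bigr)$, $\theta^k=\theta$, $L^k=L$. When functions are evaluated at a point where some $N_{\rm tot}$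 vanishes, quotients with that $N_{\rm tot}$ as denominator are given the value $0$. Dehomogenization: for each column $j$ with $R^k_{0,j}>0$, replace $R^k_{:,j}$ by $R^k_{:,j}/R^k_{0,j}$ and $\mu^k_j(1;x)$ by $R^k_{0,j}\mu^k_j(1;x)$; other columns are unchanged. *)

(* Defs.v *)
From HB Require Import structures.
From mathcomp Require Import all_boot all_order all_algebra.
From mathcomp Require Import all_classical all_reals all_analysis.
Import Order.TTheory GRing.Theory Num.Theory numFieldNormedType.Exports.

Set Implicit Arguments.
Unset Strict Implicit.
Unset Printing Implicit Defensive.

Local Open Scope classical_set_scope.
Local Open Scope ring_scope.

(* Minimization of [objective] over [feasible]. The variable space is an
   lmodType, so that [convex_set] and [convex_function] apply. *)
Record problem (R : realType) := Problem {
  variables : lmodType R;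
  feasible : set variables;
  objective : variables -> R }.

(* Problems may be unbounded below and minima need not be attained: the optimal
   value is an extended real infimum. *)
Definition opt_value (R : realType) (Q : problem R) : \bar R :=
  ereal_inf [set (objective v)%:E | v in @feasible R Q].

(* Q' is a relaxation of Q. *)
Definition relaxes (R : realType) (Q' Q : problem R) : Prop :=
  forall v, @feasible R Q v ->
    exists2 w, @feasible R Q' w & objective w <= objective v.

Definition convex_problem (R : realType) (Q : problem R) : Prop :=
  @convex_set R (variables Q) (@feasible R Q) /\
  @convex_function R (variables Q) (@feasible R Q) (@objective R Q).

Definition affine (R : realType) (d : nat) (f : 'cV[R]_d -> R) : Prop :=
  exists (l : {scalar 'cV[R]_d}) (c : R), forall y, f y = l y + c.

Definition polyhedron (R : realType) (m n : nat) (A : 'M[R]_(m, n))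
    (b : 'cV[R]_m) : set 'cV[R]_n :=
  [set x | forall i, (A *m x) i 0 <= b i 0].

Definition homog (R : realType) (n : nat) (x : 'cV[R]_n) : 'cV[R]_n.+1 :=
  col_mx (const_mx 1 : 'cV[R]_1) x.

(* The double description method maintains matrices R^k (rays) and L^k
   (lineality) together with vectors mu^k and theta^k of functions of (x_0; x).
   A [gen] is a column of R^k (resp. L^k) paired with the corresponding entry of
   mu^k (resp. theta^k). *)
Definition gen (R : realType) (n : nat) : Type :=
  ('cV[R]_n.+1 * ('cV[R]_n.+1 -> R))%type.

Record dd_state (R : realType) (n : nat) := DDState {
  lin : seq (gen R n);    (* (L^k, theta^k) *)
  ray : seq (gen R n) }.  (* (R^k, mu^k) *)

Section DoubleDescription.
Context {R : realType} {n : nat}.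
Implicit Types (a : 'rV[R]_n.+1) (c d : gen R n) (s : seq (gen R n))
  (S : dd_state R n).

Definition coef a c : R := (a *m c.1) 0 0.

(* As if the constraints x_0 >= 0 and x_j >= 0, j > rho, were already processed;
   coordinates are numbered 0, ..., n. *)
Definition dd_init (rho : nat) : dd_state R n :=
  let e (j : 'I_n.+1) : gen R n := (delta_mx j 0, fun z : 'cV[R]_n.+1 => z j 0) in
  DDState [seq e j | j : 'I_n.+1 <- enum 'I_n.+1 & (0 < j <= rho)%N]
          [seq e j | j : 'I_n.+1 <- enum 'I_n.+1 & ~~ (0 < j <= rho)%N].

Definition dd_case1 a S : dd_state R n :=
  let xi := find (fun c => coef a c != 0) (lin S) in
  let l0 := nth ((0, fun=> 0) : gen R n) (lin S) xi in
  let l : gen R n :=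
    if coef a l0 < 0 then (- l0.1, fun z => - l0.2 z) else l0 in
  let before := take xi (lin S) in
  let after := drop xi.+1 (lin S) in
  let axi := coef a l in
  DDState
    (before ++
     [seq (axi *: c.1 - coef a c *: l.1, fun z => c.2 z / axi) | c <- after])
    ((l.1, fun z => l.2 z + \sum_(c <- after) coef a c * c.2 z / axi
                          + \sum_(c <- ray S) coef a c * c.2 z / axi) ::
     [seq (axi *: c.1 - coef a c *: l.1, fun z => c.2 z / axi) | c <- ray S]).

(* Quotients by a vanishing [Ntot z] are 0, since 0^-1 = 0. *)
Definition dd_case2 a S : dd_state R n :=
  let Nneg := [seq c <- ray S | coef a c < 0] in
  let Nzero := [seq c <- ray S | coef a c == 0] in
  let Npos := [seq c <- ray S | 0 < coef a c] in
  let Ntot z := \sum_(c <- Npos) c.2 z * coef a c in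
  DDState (lin S)
    (Nzero ++
     [seq (c.1, fun z =>
             c.2 z + \sum_(d <- Nneg) d.2 z * c.2 z * coef a d / Ntot z)
        | c <- Npos] ++
     [seq (coef a c *: d.1 - coef a d *: c.1,
           fun z => d.2 z * c.2 z / Ntot z) | c <- Npos, d <- Nneg]).

Definition dd_step S a : dd_state R n :=
  if has (fun c => coef a c != 0) (lin S) then dd_case1 a S else dd_case2 a S.

(* The state after the first k rows of Abar (all m rows when k >= m). *)
Definition dd (m : nat) (Abar : 'M[R]_(m, n.+1)) (rho k : nat) : dd_state R n :=
  foldl dd_step (dd_init rho) (take k [seq row i Abar | i <- enum 'I_m]).

Definition dehomogenize s : seq (gen R n) :=
  [seq (if 0 < c.1 0 0
        then ((c.1 0 0)^-1 *: c.1, fun z => c.1 0 0 * c.2 z) else c) | c <- s].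

Definition gen_mx s : 'M[R]_(n.+1, size s) :=
  \matrix_(j, i) (tnth (in_tuple s) i).1 j 0.

Definition gen_mu s (x : 'cV[R]_n) : 'cV[R]_(size s) :=
  \col_i (tnth (in_tuple s) i).2 (homog x).

End DoubleDescription.

Section Problems.
Context {R : realType} {n d : nat}.
Context (g : 'I_n.+1 -> 'cV[R]_d -> R) (C : set 'cV[R]_d).

Definition gvec (y : 'cV[R]_d) : 'rV[R]_n.+1 := \row_j g j y.

Definition ac_problem (P : set 'cV[R]_n) : problem R :=
  @Problem R ('cV[R]_d * 'cV[R]_n)%type
    [set v | C v.1 /\ P v.2]
    (fun v => g 0 v.1 + \sum_(i < n) v.2 i 0 * g (lift ord0 i) v.1).

Section Disaggregated.
Context {p : nat} (V : 'M[R]_(n.+1, p)).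
Implicit Types (lam : 'cV[R]_p) (W : 'M[R]_(d, p)).

(* The i-th column of W stands for y^i (or y mu_i). Terms with lam_i = 0
   vanish, in accordance with the convention for perspectives. *)
Definition disagg_objective lam W : R :=
  \sum_(i < p) (gvec ((lam i 0)^-1 *: col i W) *m col i V) 0 0 * lam i 0.

Definition disagg_constraints lam W (x : 'cV[R]_n) : Prop :=
  [/\ forall i, [set lam i 0 *: c | c in C] (col i W),
      forall i, 0 <= lam i 0 &
      V *m lam = homog x].

(* Variables ((x, lambda), (y^i)_i): the mu_i(1; x) are replaced by lambda_i and
   the products y mu_i(1; x) by the columns of a matrix. *)
Definition acd_lifted_problem : problem R :=
  @Problem R ('cV[R]_n * 'cV[R]_p * 'M[R]_(d, p))%type
    [set v | disagg_constraints v.1.2 v.2 v.1.1]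
    (fun v => disagg_objective v.1.2 v.2).

Definition acd_problem (mu : 'cV[R]_n -> 'cV[R]_p) : problem R :=
  @Problem R ('cV[R]_d * 'cV[R]_n)%type
    [set v | disagg_constraints (mu v.2) (v.1 *m (mu v.2)^T) v.2]
    (fun v => disagg_objective (mu v.2) (v.1 *m (mu v.2)^T)).

End Disaggregated.
End Problems.

(* Main.v *)
Require Import Defs.
From mathcomp Require Import all_boot all_order all_algebra.
From mathcomp Require Import all_classical all_reals all_analysis.
From mathcomp Require Import ring lra.
Set Implicit Arguments.
Unset Strict Implicit.
Unset Printing Implicit Defensive.
Import Order.TTheory GRing.Theory Num.Theory numFieldNormedType.Exports.
Local Open Scope classical_set_scope.
Local Open Scope ring_scope.

(** Two ingredients carry the proof.

    Convexity. The contribution of a generator v to the lifted objective,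
    [ray_term g v s w] = sum_j v_j s g_j(w/s), is linear in v and positively
    homogeneous in (s, w). It is subadditive in (s, w), for w in s C, as soon as
    every coordinate v_j with g_j not affine is nonnegative
    ([ray_termD_le]). Hence the lifted problem is convex ([lifted_convex]).
    Moreover, if the columns of V' are conic combinations of those of V, say
    V' = V M with M >= 0, then (lam, W) |-> (M lam, W M^T) maps feasible points
    for V' to feasible points for V and does not increase the objective
    ([lifted_relaxes]). If each column of V is zero or of the form (1; x) with x
    in P, the lifted objective is a weighted mean of values of the original one,
    one of which is therefore at most the mean ([ac_relaxes_lifted]).

    Double description. Three invariants are maintained. First, rays satisfy,
    and lineality vectors satisfy with equality, all inequalities processed so
    far, including the sign constraints built into the initial state
    ([valid_step], [valid_step_new]). Second, for each z satisfying all the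
    inequalities, the functions mu and theta are coordinates of z on the
    generators, with mu(z) >= 0 ([resolves_step]); thus (y, x) is feasible, with
    the same value, for the disaggregated problem ([acd_relaxes_ac]). Third, the
    functions theta are linear and triangularly dual to the lineality vectors
    ([triangular_dual_step]), so that these are nonzero.

    As P is nonempty and bounded, the homogenized system has no nonzero solution
    with z_0 = 0. So the lineality part is empty once all rows are processed,
    and a final generator is either zero or, after dehomogenization, of the form
    (1; x) with x in P. While the lineality part is empty, a step replaces
    the rays by conic combinations of them ([dehomogenize_step_conic]), whence
    the monotonicity of the optimal values. *)

(** * Perspective functions *)

Section Perspective.
Context {R : realType} {n d : nat}.
Implicit Types (f : 'cV[R]_d -> R) (C : set 'cV[R]_d) (s t : R)
  (v : 'cV[R]_n.+1).

Lemma convex_set_weighted C s t x y : @convex_set R 'cV[R]_d C ->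
  0 <= s -> 0 <= t -> s + t = 1 -> C x -> C y -> C (s *: x + t *: y).
Proof.
move=> cC s0 t0 st1 Cx Cy.
have s1 : s <= 1 by lra.
have := cC x y (Itv01 s0 s1); rewrite !inE => /(_ Cx Cy).
by rewrite (_ : t = 1 - s) //; lra.
Qed.

Lemma convex_function_weighted f s t x y :
  @convex_function R 'cV[R]_d setT f ->
  0 <= s -> 0 <= t -> s + t = 1 ->
  f (s *: x + t *: y) <= s * f x + t * f y.
Proof.
move=> cf s0 t0 st1.
have s1 : s <= 1 by lra.
have := cf (Itv01 s0 s1) x y; rewrite !in_setT => /(_ isT isT).
by rewrite (_ : t = 1 - s) //; lra.
Qed.

Lemma affine_weighted f s t x y : affine f -> s + t = 1 ->
  f (s *: x + t *: y) = s * f x + t * f y.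
Proof.
move=> [l [c fE]] st1; rewrite !fE linearD !linearZ /=.
by rewrite !mulrDr addrACA -mulrDl st1 mul1r.
Qed.

(** The perspective s f(w/s) of f, which is 0 for s = 0. *)
Definition persp f s (w : 'cV[R]_d) : R := f (s^-1 *: w) * s.

(** The set s C, and the empty set when s is negative. *)
Definition dilation C s : set 'cV[R]_d :=
  [set w | 0 <= s /\ [set s *: c | c in C] w].

Lemma dilation0 C : C !=set0 -> dilation C 0 0.
Proof. by move=> [c Cc]; split => //; exists c => //; rewrite scale0r. Qed.

Lemma dilationZ C s a w :
  0 <= a -> dilation C s w -> dilation C (a * s) (a *: w).
Proof.
move=> a0 [s0 [c Cc <-]]; split; first exact: mulr_ge0.
by exists c => //; rewrite scalerA.
Qed.

Lemma dilationD C s t w u : @convex_set R 'cV[R]_d C ->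
  dilation C s w -> dilation C t u -> dilation C (s + t) (w + u).
Proof.
move=> cC [s0 [c Cc <-]] [t0 [e Ce <-]]; split; first exact: addr_ge0.
have [st0|st0] := eqVneq (s + t) 0.
  have [-> ->] : s = 0 /\ t = 0 by split; lra.
  by exists c => //; rewrite addr0 !scale0r addr0.
exists ((s / (s + t)) *: c + (t / (s + t)) *: e).
  have stp : 0 <= s + t by rewrite addr_ge0.
  apply: convex_set_weighted => //; [exact: divr_ge0|exact: divr_ge0|].
  by rewrite -mulrDl divff.
by rewrite scalerDr !scalerA !(mulrCA (s + t)) divff // !mulr1.
Qed.

Lemma persp0 f w : persp f 0 w = 0.
Proof. by rewrite /persp mulr0. Qed.

Lemma perspZ f a s w : persp f (a * s) (a *: w) = a * persp f s w.
Proof.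
rewrite /persp; have [->|a0] := eqVneq a 0; first by rewrite !mul0r mulr0.
by rewrite scalerA invfM mulrAC mulVf // mul1r mulrCA.
Qed.

(** The hypothesis covers two cases at once: f convex with a >= 0, and f affine
    with a of arbitrary sign. *)
Lemma perspD_le C f (a : R) s t w u :
  (forall p q x y, 0 <= p -> 0 <= q -> p + q = 1 ->
     a * f (p *: x + q *: y) <= a * (p * f x + q * f y)) ->
  dilation C s w -> dilation C t u ->
  a * persp f (s + t) (w + u) <= a * (persp f s w + persp f t u).
Proof.
move=> af [s0 [c Cc <-]] [t0 [e Ce <-]].
have [s00|sn0] := eqVneq s 0.
  by rewrite s00 !scale0r !add0r persp0 add0r.
have [t00|tn0] := eqVneq t 0.
  by rewrite t00 !scale0r !addr0 persp0 addr0.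
have st0 : 0 < s + t by rewrite ltr_pwDl // lt_neqAle eq_sym sn0.
rewrite /persp !scalerA !mulVf // !scale1r scalerDr !scalerA.
have := af ((s + t)^-1 * s) ((s + t)^-1 * t) c e.
rewrite !mulr_ge0 ?invr_ge0 ?(ltW st0) // => /(_ isT isT).
rewrite -mulrDr mulVf ?gt_eqF // => /(_ erefl) /(ler_wpM2r (ltW st0)).
rewrite -!mulrA => /le_trans -> //.
rewrite le_eqVlt; apply/orP; left; apply/eqP; congr (a * _).
by field; rewrite gt_eqF.
Qed.

Section Ray.
Context (g : 'I_n.+1 -> 'cV[R]_d -> R).

(** The term of the disaggregated objective that belongs to the column v, with
    multiplier s and disaggregated variable w. *)
Definition ray_term v s (w : 'cV[R]_d) : R :=
  (gvec g (s^-1 *: w) *m v) 0 0 * s.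

Lemma ray_termE v s w : ray_term v s w = \sum_j v j 0 * persp (g j) s w.
Proof.
rewrite /ray_term mxE mulr_suml; apply: eq_bigr => j _.
by rewrite mxE /persp mulrA [v j 0 * _]mulrC.
Qed.

Lemma ray_term0 v w : ray_term v 0 w = 0.
Proof. by rewrite /ray_term mulr0. Qed.

Lemma ray_termZ v a s w : ray_term v (a * s) (a *: w) = a * ray_term v s w.
Proof.
rewrite !ray_termE mulr_sumr; apply: eq_bigr => j _.
by rewrite perspZ mulrCA.
Qed.

Lemma ray_term_mulmx p (V : 'M[R]_(n.+1, p)) (u : 'cV[R]_p) s w :
  ray_term (V *m u) s w = \sum_i u i 0 * ray_term (col i V) s w.
Proof.
rewrite /ray_term mulmxA mxE mulr_suml; apply: eq_bigr => i _.
have -> : (gvec g (s^-1 *: w) *m col i V) 0 0 = (gvec g (s^-1 *: w) *m V) 0 i.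
  by rewrite !mxE; apply: eq_bigr => j _; rewrite !mxE.
by ring.
Qed.

(** A condition on v that makes [ray_term v] sublinear. *)
Definition sublinear_direction v :=
  forall j, affine (g j) \/
    (@convex_function R 'cV[R]_d setT (g j) /\ 0 <= v j 0).

Lemma ray_termD_le C v s t w u : sublinear_direction v ->
  dilation C s w -> dilation C t u ->
  ray_term v (s + t) (w + u) <= ray_term v s w + ray_term v t u.
Proof.
move=> vdir Cw Cu; rewrite !ray_termE -big_split /=; apply: ler_sum => j _.
rewrite -mulrDr; apply: (perspD_le _ Cw Cu) => p q x y p0 q0 pq1.
have [ga|[gc vj]] := vdir j; first by rewrite affine_weighted.
exact/ler_wpM2l/convex_function_weighted.
Qed.

Lemma ray_term_sum_le C v (I : finType) (S : I -> R) (W : I -> 'cV[R]_d) :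
  C !=set0 -> @convex_set R 'cV[R]_d C -> sublinear_direction v ->
  (forall i, dilation C (S i) (W i)) ->
  dilation C (\sum_i S i) (\sum_i W i) /\
  ray_term v (\sum_i S i) (\sum_i W i) <= \sum_i ray_term v (S i) (W i).
Proof.
move=> C0 cC vdir CW.
pose K s w (r : R) := dilation C s w /\ ray_term v s w <= r.
apply: (big_rec3 K); first by split; [exact: dilation0|rewrite ray_term0].
move=> i s w r _ [Ks Kr]; split; first exact: dilationD.
by apply: le_trans (ray_termD_le vdir (CW i) Ks) _; rewrite lerD2l.
Qed.

End Ray.
End Perspective.

(** * Relaxations between the three problems *)

Lemma opt_value_relaxes (R : realType) (Q' Q : problem R) :
  relaxes Q' Q -> (opt_value Q' <= opt_value Q)%E.
Proof.
move=> Q'Q; apply: le_ereal_inf_tmp => _ [v Qv <-].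
have [w Q'w wv] := Q'Q v Qv.
by apply: ereal_inf_le; exists (objective w)%:E; [exists w|rewrite lee_fin].
Qed.

Section Problems.
Context {R : realType} {n d : nat}.
Context (g : 'I_n.+1 -> 'cV[R]_d -> R) (C : set 'cV[R]_d).
Context (C0 : C !=set0) (cC : @convex_set R 'cV[R]_d C).

Lemma homog_weighted s t (x y : 'cV[R]_n) : s + t = 1 ->
  homog (s *: x + t *: y) = s *: homog x + t *: homog y.
Proof.
move=> st1; apply/matrixP => i j; rewrite /homog !mxE.
by case: splitP => k _; rewrite !mxE // !mulr1.
Qed.

Lemma homog0 (x : 'cV[R]_n) : homog x 0 0 = 1.
Proof. by rewrite /homog mxE; case: splitP => // j _; rewrite mxE. Qed.

Lemma homog_lift (x : 'cV[R]_n) i : homog x (lift ord0 i) 0 = x i 0.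
Proof.
have -> : lift ord0 i = rshift 1 i by apply: val_inj.
exact: col_mxEd.
Qed.

Lemma disagg_constraintsE p (V : 'M[R]_(n.+1, p)) lam W x :
  disagg_constraints C V lam W x <->
  (forall i, dilation C (lam i 0) (col i W)) /\ V *m lam = homog x.
Proof.
split=> [[CW lam0 Vx]|[CW Vx]]; first by split.
by split=> // i; case: (CW i).
Qed.

Lemma disagg_objectiveE p (V : 'M[R]_(n.+1, p)) lam W :
  disagg_objective g V lam W = \sum_i ray_term g (col i V) (lam i 0) (col i W).
Proof. by []. Qed.

Lemma col_mulmx_tr p q (W : 'M[R]_(d, q)) (M : 'M[R]_(p, q)) i :
  col i (W *m M^T) = \sum_j M i j *: col j W.
Proof.
apply/matrixP => k l; rewrite !mxE summxE; apply: eq_bigr => j _.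
by rewrite !mxE mulrC.
Qed.

(** Aggregating the multipliers along V' = V M can only lower the objective, by
    sublinearity in the directions of the columns of V. *)
Lemma lifted_relaxes p q (V : 'M[R]_(n.+1, p)) (M : 'M[R]_(p, q)) :
  (forall i, sublinear_direction g (col i V)) -> (forall i j, 0 <= M i j) ->
  relaxes (acd_lifted_problem g C V) (acd_lifted_problem g C (V *m M)).
Proof.
move=> Vdir M0 [[x lam] W] /disagg_constraintsE /= [CW Vx].
have aux i : dilation C ((M *m lam) i 0) (col i (W *m M^T)) /\
    ray_term g (col i V) ((M *m lam) i 0) (col i (W *m M^T)) <=
    \sum_j M i j * ray_term g (col i V) (lam j 0) (col j W).
  under eq_bigr => j _ do rewrite -ray_termZ.
  rewrite mxE col_mulmx_tr; apply: ray_term_sum_le => // j.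
  exact: dilationZ.
exists (x, M *m lam, W *m M^T) => /=.
  apply/disagg_constraintsE; split=> [i|]; first exact: (aux i).1.
  by rewrite mulmxA.
rewrite !disagg_objectiveE.
apply: (@le_trans _ _ (\sum_i \sum_j
    M i j * ray_term g (col i V) (lam j 0) (col j W))).
  by apply: ler_sum => i _; exact: (aux i).2.
rewrite exchange_big /=; apply: ler_sum => j _.
have -> : col j (V *m M) = V *m col j M by rewrite !colE mulmxA.
rewrite ray_term_mulmx.
by apply: ler_sum => i _; rewrite mxE.
Qed.

Lemma lifted_convex p (V : 'M[R]_(n.+1, p)) :
  (forall i, sublinear_direction g (col i V)) ->
  convex_problem (acd_lifted_problem g C V).
Proof.
move=> Vdir; split.
  move=> [[x lam] W] [[y mu] U] t; rewrite !inE.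
  move=> /disagg_constraintsE /= [CW Vx] /disagg_constraintsE /= [CU Vy].
  have t0 : 0 <= t%:num by [].
  have t1 : 0 <= 1 - t%:num by rewrite subr_ge0.
  apply/disagg_constraintsE => /=; split.
    move=> i; rewrite !mxE !linearD !linearZ /=.
    by apply: dilationD => //; exact: dilationZ.
  by rewrite homog_weighted ?mulmxDr -?scalemxAr ?Vx ?Vy // subrKC.
move=> t [[x lam] W] [[y mu] U]; rewrite !inE.
move=> /disagg_constraintsE /= [CW Vx] /disagg_constraintsE /= [CU Vy].
have t0 : 0 <= t%:num by [].
have t1 : 0 <= 1 - t%:num by rewrite subr_ge0.
rewrite convRE !disagg_objectiveE /= !mulr_sumr -big_split /=.
apply: ler_sum => i _; rewrite !mxE !linearD !linearZ /= -!ray_termZ.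
by apply: ray_termD_le => //; exact: dilationZ.
Qed.

Lemma lifted_relaxes_acd p (V : 'M[R]_(n.+1, p)) (mu : 'cV[R]_n -> 'cV[R]_p) :
  relaxes (acd_lifted_problem g C V) (acd_problem g C V mu).
Proof.
by move=> [y x] /= Fv; exists (x, mu x, y *m (mu x)^T).
Qed.

Lemma gvec_homog (y : 'cV[R]_d) (x : 'cV[R]_n) :
  (gvec g y *m homog x) 0 0 = g 0 y + \sum_(i < n) x i 0 * g (lift ord0 i) y.
Proof.
rewrite mxE big_ord_recl homog0 mulr1 mxE; congr (_ + _).
by apply: eq_bigr => i _; rewrite homog_lift mxE mulrC.
Qed.

(** The point (y, x) keeps its value, since V mu(x) = (1; x). *)
Lemma acd_relaxes_ac p (V : 'M[R]_(n.+1, p)) (mu : 'cV[R]_n -> 'cV[R]_p)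
    (P : set 'cV[R]_n) :
  (forall x, P x -> (forall i, 0 <= mu x i 0) /\ V *m mu x = homog x) ->
  relaxes (acd_problem g C V mu) (ac_problem g C P).
Proof.
move=> Pmu [y x] /= [Cy Px]; have [mu0 Vmu] := Pmu _ Px.
have colE i : col i (y *m (mu x)^T) = mu x i 0 *: y.
  by apply/matrixP => k l; rewrite !mxE big_ord1 !mxE [l]ord1 mulrC.
exists (y, x) => /=.
  apply/disagg_constraintsE; split=> // i; split=> //.
  by exists y => //; rewrite colE.
rewrite disagg_objectiveE -gvec_homog -Vmu mulmxA mxE.
rewrite le_eqVlt; apply/orP; left; apply/eqP/eq_bigr => i _.
rewrite colE /ray_term.
have [->|mui] := eqVneq (mu x i 0) 0; first by rewrite !mulr0.
rewrite scalerA mulVf // scale1r; congr (_ * _).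
by rewrite !mxE; apply: eq_bigr => j _; rewrite !mxE.
Qed.

(** A lifted point is a mixture, with weights V_0i lam_i of sum 1, of feasible
    points of the original problem; one of these is at least as good. *)
Lemma ac_relaxes_lifted p (V : 'M[R]_(n.+1, p)) (P : set 'cV[R]_n) :
  (forall i, col i V = 0 \/ exists2 x, P x & col i V = homog x) ->
  relaxes (ac_problem g C P) (acd_lifted_problem g C V).
Proof.
move=> PV [[x lam] W] /disagg_constraintsE /= [CW Vx].
set F := (disagg_objective _ _ _ _).
have lam0 i : 0 <= lam i 0 by case: (CW i).
have lam1 : \sum_i V 0 i * lam i 0 = 1 by rewrite -(homog0 x) -Vx mxE.
have FE : F = \sum_i ray_term g (col i V) (lam i 0) (col i W) by [].
(* Otherwise every mixed value exceeds F, and so does their mean F. *)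
apply: contrapT => noF.
have ltF i : lam i 0 != 0 -> col i V != 0 ->
    F * (V 0 i * lam i 0) < ray_term g (col i V) (lam i 0) (col i W).
  move=> lami Vi; case: (PV i) => [V0|[v Pv Vv]].
    by rewrite V0 eqxx in Vi.
  have -> : V 0 i = 1 by rewrite -(homog0 v) -Vv mxE.
  have li0 : 0 < lam i 0 by rewrite lt_neqAle eq_sym lami lam0.
  rewrite mul1r /ray_term ltr_pM2r //.
  rewrite ltNge; apply/negP => le_F; apply: noF.
  case: (CW i) => _ [c Cc cW].
  exists (c, v) => //=; rewrite -gvec_homog -Vv.
  by rewrite -cW scalerA mulVf // scale1r in le_F.
have leF i : F * (V 0 i * lam i 0) <= ray_term g (col i V) (lam i 0) (col i W).
  have [l0|lami] := eqVneq (lam i 0) 0; first by rewrite l0 ray_term0 !mulr0.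
  have [V0|Vi] := eqVneq (col i V) 0; last exact/ltW/ltF.
  have -> : V 0 i = 0 by move/matrixP: V0 => /(_ 0 0); rewrite !mxE.
  by rewrite V0 /ray_term mulmx0 mxE !mul0r mulr0.
suff : F < F by rewrite ltxx.
rewrite -[X in X < _]mulr1 -lam1 mulr_sumr [ltRHS]FE.
have [i lamVi] : exists i, V 0 i * lam i 0 != 0.
  apply: contrapT => /forallNP V0; move: lam1; rewrite big1.
    by move/eqP; rewrite eq_sym oner_eq0.
  by move=> i _; have /negP/negPn/eqP := V0 i.
rewrite (bigD1 i) //= [ltRHS](bigD1 i) //=; apply: ltr_leD.
  move: lamVi; rewrite mulf_eq0 negb_or => /andP[Vi li]; apply: ltF => //.
  by apply: contra_neq Vi => /matrixP /(_ 0 0); rewrite !mxE.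
by apply: ler_sum => j _; exact: leF.
Qed.

End Problems.

(** * Steps of the double description method *)

Section DoubleDescription.
Context {R : realType} {n : nat}.
Implicit Types (a : 'rV[R]_n.+1) (c l : gen R n) (s : seq (gen R n))
  (S : dd_state R n) (z : 'cV[R]_n.+1).

Definition gen_opp l : gen R n := (- l.1, fun z => - l.2 z).

(** The generator c, pushed along the pivot l into the kernel of a. *)
Definition eliminate a l c : gen R n :=
  (coef a l *: c.1 - coef a c *: l.1, fun z => c.2 z / coef a l).

(** The conic combination of c and l that lies in the kernel of a, when a is
    positive on c and negative on l. *)
Definition combine (Ntot : 'cV[R]_n.+1 -> R) a c l : gen R n :=
  (coef a c *: l.1 - coef a l *: c.1, fun z => l.2 z * c.2 z / Ntot z).

Lemma coef_opp a l : coef a (gen_opp l) = - coef a l.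
Proof. by rewrite /coef mulmxN mxE. Qed.

Lemma coef_comb a x y c l e : e.1 = x *: c.1 - y *: l.1 ->
  coef a e = x * coef a c - y * coef a l.
Proof. by rewrite /coef => ->; rewrite mulmxBr -!scalemxAr !mxE. Qed.

Lemma coef_eliminate a a' l c :
  coef a' (eliminate a l c) = coef a l * coef a' c - coef a c * coef a' l.
Proof. exact: coef_comb. Qed.

(** The first lineality vector l0 on which a does not vanish is turned, up to
    sign, into the ray l. *)
Lemma dd_stepE_pivot S a : has (fun c => coef a c != 0) (lin S) ->
  exists before l0 after l,
    [/\ lin S = before ++ l0 :: after,
        {in before, forall c, coef a c = 0},
        0 < coef a l, l = l0 \/ l = gen_opp l0 &
        dd_step S a = DDState (before ++ map (eliminate a l) after)
          ((l.1, fun z => l.2 z + \sum_(c <- after) coef a c * c.2 z / coef a l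
                         + \sum_(c <- ray S) coef a c * c.2 z / coef a l) ::
           map (eliminate a l) (ray S))].
Proof.
move=> hasl; rewrite /dd_step hasl /dd_case1.
set xi := find _ _; set l0 := nth _ _ _; set l : gen R n := if _ then _ else _.
exists (take xi (lin S)), l0, (drop xi.+1 (lin S)), l.
have xi_lt : (xi < size (lin S))%N by rewrite -has_find.
have coef_l0 : coef a l0 != 0 by apply: (nth_find (0, fun=> 0) hasl).
split.
- by rewrite -{1}(cat_take_drop xi (lin S)) (drop_nth (0, fun=> 0)).
- move=> c /(nthP (0, fun=> 0))[i]; rewrite size_take xi_lt => i_lt <-.
  by rewrite nth_take //; apply/eqP/negPn; rewrite (before_find _ i_lt).
- rewrite /l; case: (ltP (coef a l0) 0) => [neg|pos].
    by rewrite (coef_opp a l0) oppr_gt0.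
  by rewrite lt_neqAle eq_sym coef_l0.
- by rewrite /l; case: ifP => _; [right|left].
- by [].
Qed.

(** The rays on which a is negative, zero and positive. *)
Definition part_neg a S := [seq c <- ray S | coef a c < 0].
Definition part_zero a S := [seq c <- ray S | coef a c == 0].
Definition part_pos a S := [seq c <- ray S | 0 < coef a c].

(** The normalizing factor N_tot. *)
Definition total_pos a S z := \sum_(c <- part_pos a S) c.2 z * coef a c.

(** A ray with positive value of a keeps its direction. If the generators
    resolve z, without lineality, and N_tot(z) <> 0, its coordinate is scaled by
    (a z) / N_tot(z). *)
Definition rescale a S c : gen R n :=
  (c.1, fun z => c.2 z + \sum_(l <- part_neg a S)
                           l.2 z * c.2 z * coef a l / total_pos a S z).

Lemma dd_stepE_combine S a : ~~ has (fun c => coef a c != 0) (lin S) ->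
  dd_step S a = DDState (lin S)
    (part_zero a S ++ map (rescale a S) (part_pos a S) ++
     [seq combine (total_pos a S) a c l
        | c <- part_pos a S, l <- part_neg a S]).
Proof. by move=> /negbTE nhas; rewrite /dd_step nhas. Qed.

(** The cone generated by the rays and the lineality vectors, the latter with
    both signs, lies in the half-space where a is nonnegative. *)
Definition valid a S :=
  {in ray S, forall c, 0 <= coef a c} /\ {in lin S, forall c, coef a c = 0}.

Lemma ray_combineP S a c : ~~ has (fun c => coef a c != 0) (lin S) ->
  c \in ray (dd_step S a) ->
  [\/ exists2 c', c' \in ray S /\ 0 <= coef a c' & c.1 = c'.1 |
      exists c1 c2, [/\ c1 \in ray S /\ 0 < coef a c1,
        c2 \in ray S /\ coef a c2 < 0 &
        c.1 = coef a c1 *: c2.1 - coef a c2 *: c1.1]].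
Proof.
move=> /dd_stepE_combine -> /=; rewrite !mem_cat.
move=> /or3P[|/mapP[c']|/allpairsP[]].
- by rewrite mem_filter => /andP[/eqP c0 cS]; left; exists c; rewrite ?c0.
- by rewrite mem_filter => /andP[c0 cS] ->; left; exists c' => //; rewrite ltW.
- move=> [c1 c2] /=; rewrite !mem_filter => -[/andP[c1p c1S] /andP[c2n c2S] ->].
  by right; exists c1, c2.
Qed.

Lemma valid_step a a' S : valid a S -> valid a (dd_step S a').
Proof.
move=> [rS lS].
have [hasl|nhas] := boolP (has (fun c => coef a' c != 0) (lin S)).
  have [before [l0 [after [l [linE _ l_pos l_l0 ->]]]]] := dd_stepE_pivot hasl.
  have l0a : coef a l0 = 0 by apply: lS; rewrite linE mem_cat inE eqxx orbT.
  have la : coef a l = 0 by case: l_l0 => ->; rewrite ?coef_opp l0a ?oppr0.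
  split=> /= c.
    rewrite inE => /orP[/eqP ->|/mapP[c' c'S ->]].
      by rewrite /coef -/(coef a l) la.
    by rewrite coef_eliminate la mulr0 subr0 mulr_ge0 ?(ltW l_pos) ?rS.
  rewrite mem_cat => /orP[cb|/mapP[c' c'S ->]].
    by apply: lS; rewrite linE mem_cat cb.
  have c'0 : coef a c' = 0 by apply: lS; rewrite linE mem_cat inE c'S !orbT.
  by rewrite coef_eliminate la c'0 !mulr0 subr0.
split=> c; last by rewrite dd_stepE_combine //; exact: lS.
case/(ray_combineP nhas) =>
    [[c' [c'S _] cE]|[c1 [c2 [[c1S c1p] [c2S c2n] cE]]]].
  by rewrite /coef cE -/(coef a c') rS.
rewrite (coef_comb a cE) subr_ge0 (@le_trans _ _ 0) //.
  by rewrite mulr_le0_ge0 ?rS // ltW.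
by rewrite mulr_ge0 ?rS // ltW.
Qed.

Lemma valid_step_new a S : valid a (dd_step S a).
Proof.
have [hasl|nhas] := boolP (has (fun c => coef a c != 0) (lin S)).
  have [before [l0 [after [l]]]] := dd_stepE_pivot hasl.
  move=> [linE before0 l_pos _ ->].
  have elim0 c : coef a (eliminate a l c) = 0.
    by rewrite coef_eliminate mulrC subrr.
  split=> /= c.
    rewrite inE => /orP[/eqP ->|/mapP[c' c'S ->]]; last by rewrite elim0.
    exact: ltW.
  by rewrite mem_cat => /orP[/before0|/mapP[c' c'S ->]].
split=> c; last first.
  rewrite dd_stepE_combine // => cS; apply/eqP/negPn.
  by move/hasPn: nhas => /(_ _ cS).
case/(ray_combineP nhas) => [[c' [_ c'0] cE]|[c1 [c2 [_ _ cE]]]].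
  by rewrite /coef cE.
by rewrite (coef_comb a cE) mulrC subrr.
Qed.

(** The functions attached to the generators are coordinates of z on them,
    nonnegative on the rays. *)
Definition resolves z S :=
  {in ray S, forall c, 0 <= c.2 z} /\
  \sum_(c <- lin S) c.2 z *: c.1 + \sum_(c <- ray S) c.2 z *: c.1 = z.

Lemma resolves_coef a z S : resolves z S ->
  (a *m z) 0 0 = \sum_(c <- lin S) coef a c * c.2 z
               + \sum_(c <- ray S) coef a c * c.2 z.
Proof.
move=> [_ {1}<-]; rewrite mulmxDr !mulmx_sumr mxE !summxE.
by congr (_ + _); apply: eq_bigr => c _; rewrite -scalemxAr mxE mulrC.
Qed.

Lemma sum_eliminate a l s z : coef a l != 0 ->
  \sum_(c <- map (eliminate a l) s) c.2 z *: c.1 =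
  \sum_(c <- s) c.2 z *: c.1 -
  (\sum_(c <- s) coef a c * c.2 z / coef a l) *: l.1.
Proof.
move=> al; rewrite big_map scaler_suml -sumrB; apply: eq_bigr => c _ /=.
rewrite scalerBr !scalerA divfK //; congr (_ - _ *: _).
by ring.
Qed.

(** The coordinate of the new ray l is (a z) / (a l), hence nonnegative. *)
Lemma resolves_step_pivot a z S : has (fun c => coef a c != 0) (lin S) ->
  0 <= (a *m z) 0 0 -> resolves z S -> resolves z (dd_step S a).
Proof.
move=> hasl az zS; have [before [l0 [after [l]]]] := dd_stepE_pivot hasl.
move=> [linE before0 l_pos l_l0 ->].
have al : coef a l != 0 by rewrite gt_eqF.
have lE : l.2 z *: l.1 = l0.2 z *: l0.1.
  by case: l_l0 => -> //=; rewrite scaleNr scalerN opprK.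
have alE : coef a l * l.2 z = coef a l0 * l0.2 z.
  by case: l_l0 => -> //=; rewrite coef_opp mulrNN.
have azE := resolves_coef a zS.
move: azE; rewrite linE big_cat big_cons /= big1_seq; last first.
  by move=> c /andP[_ cb]; rewrite before0 // mul0r.
rewrite add0r -alE => azE.
case: zS => zS; rewrite linE big_cat big_cons /= -lE => zE.
set sa := \sum_(c <- after) coef a c * c.2 z / coef a l.
set sr := \sum_(c <- ray S) coef a c * c.2 z / coef a l.
split=> /= [c|].
  rewrite inE => /orP[/eqP -> /=|/mapP[c' c'S -> /=]]; last first.
    by rewrite divr_ge0 ?zS // ltW.
  suff -> : l.2 z + sa + sr = (a *m z) 0 0 / coef a l.
    by rewrite divr_ge0 // ltW.
  by rewrite azE /sa /sr -!mulr_suml !mulrDl mulrAC divff // mul1r.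
rewrite -[RHS]zE big_cat big_cons /= !sum_eliminate // -/sa -/sr !scalerDl.
rewrite -!addrA; congr (_ + _).
set x := \sum_(c <- after) _; set y := \sum_(c <- ray S) _.
rewrite [RHS]addrCA; congr (_ + _); rewrite [sr *: _ + _]addrC subrK.
by rewrite addrCA addKr.
Qed.

Lemma sum_parts (V : zmodType) a S (F : gen R n -> V) :
  \sum_(c <- ray S) F c = \sum_(c <- part_zero a S) F c +
    \sum_(c <- part_pos a S) F c + \sum_(c <- part_neg a S) F c.
Proof.
rewrite !big_filter (bigID (fun c => coef a c == 0)) /= -addrA; congr (_ + _).
rewrite (bigID (fun c => 0 < coef a c)) /=; congr (_ + _);
  by apply: eq_bigl => c; case: (ltgtP (coef a c) 0).
Qed.

(** The combined generators give back what rescaling removes from the rays with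
    positive value of a, together with the part of z carried by the rays with
    negative value. If N_tot(z) = 0, that part is zero because a z >= 0. *)
Lemma resolves_step_combine a z S : ~~ has (fun c => coef a c != 0) (lin S) ->
  0 <= (a *m z) 0 0 -> resolves z S -> resolves z (dd_step S a).
Proof.
move=> nhas az zS; rewrite dd_stepE_combine //.
set N := total_pos a S z.
pose M := \sum_(c <- part_neg a S) c.2 z * coef a c.
have azE : (a *m z) 0 0 = N + M.
  rewrite (resolves_coef a zS) big1_seq ?add0r; last first.
    move=> c /andP[_ cS]; move/hasPn: nhas => /(_ _ cS) /negPn/eqP ->.
    by rewrite mul0r.
  rewrite (sum_parts a) big1_seq ?add0r; last first.
    by move=> c; rewrite mem_filter => /andP[_ /andP[/eqP -> _]]; rewrite mul0r.
  by congr (_ + _); apply: eq_bigr => c _; rewrite mulrC.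
have [mu_ge0 zE] := zS.
have N0 : 0 <= N.
  rewrite /N /total_pos big_seq; apply: sumr_ge0 => c.
  by rewrite mem_filter => /andP[c0 cS]; rewrite mulr_ge0 ?mu_ge0 ?ltW.
(* If N_tot(z) = 0, the coordinates on the negative rays vanish too. *)
have mu_neg0 : N = 0 -> {in part_neg a S, forall c, c.2 z = 0}.
  move=> N00 c cn; move: (cn); rewrite mem_filter => /andP[c0 cS].
  have le0 c' : c' \in part_neg a S -> 0 <= - (c'.2 z * coef a c').
    rewrite mem_filter => /andP[c'0 c'S].
    by rewrite -mulrN mulr_ge0 ?mu_ge0 ?oppr_ge0 ?ltW.
  have M0 : \sum_(c <- part_neg a S) - (c.2 z * coef a c) = 0.
    apply/le_anti/andP; split; last by rewrite big_seq; apply: sumr_ge0.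
    by rewrite sumrN oppr_le0 -/M; move: az; rewrite azE N00 add0r.
  move: M0; rewrite big_seq => /eqP; rewrite psumr_eq0 // => /allP/(_ _ cn).
  by rewrite cn /= oppr_eq0 mulf_eq0 (lt_eqF c0) orbF => /eqP.
have rescaleE c : (rescale a S c).2 z = c.2 z * (1 + M / N).
  rewrite /rescale /= mulrDr mulr1 /M !mulr_suml mulr_sumr; congr (_ + _).
  by apply: eq_bigr => l _; rewrite -/N; ring.
split=> /= [c|].
  rewrite !mem_cat => /or3P[|/mapP[c']|/allpairsP[[c1 c2] /=]].
  - by rewrite mem_filter => /andP[_]; exact: mu_ge0.
  - rewrite mem_filter => /andP[_ c'S] ->; rewrite rescaleE mulr_ge0 ?mu_ge0 //.
    have [->|Nn0] := eqVneq N 0; first by rewrite invr0 mulr0 addr0.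
    by rewrite -(divff Nn0) -mulrDl divr_ge0 // -azE.
  - rewrite !mem_filter => -[/andP[_ c1S] /andP[_ c2S] ->] /=.
    by rewrite -/N divr_ge0 ?mulr_ge0 ?mu_ge0.
rewrite -[RHS]zE; congr (_ + _).
rewrite (sum_parts a) !big_cat /= -!addrA; congr (_ + _).
rewrite big_map big_allpairs_dep /=.
rewrite (eq_bigr (fun c =>
    c.2 z *: c.1 + (c.2 z * (M / N)) *: c.1)); last first.
  by move=> c _; have /= -> := rescaleE c; rewrite mulrDr mulr1 scalerDl.
rewrite big_split /= -addrA; congr (_ + _).
rewrite [X in _ + X](eq_bigr (fun c =>
    (c.2 z * coef a c / N) *: (\sum_(l <- part_neg a S) l.2 z *: l.1) -
    (c.2 z * (M / N)) *: c.1)); last first.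
  move=> c _; rewrite scaler_sumr /M !mulr_suml mulr_sumr scaler_suml -sumrB.
  apply: eq_bigr => l _; rewrite /= -/N scalerBr !scalerA.
  by congr (_ *: _ - _ *: _); ring.
rewrite sumrB addrC subrK -scaler_suml -mulr_suml -/(total_pos a S z) -/N.
have [N00|Nn0] := eqVneq N 0; last by rewrite divff // scale1r.
rewrite big1_seq ?scaler0 // => c /andP[_ /(mu_neg0 N00) ->].
by rewrite scale0r.
Qed.

Lemma resolves_step a z S :
  0 <= (a *m z) 0 0 -> resolves z S -> resolves z (dd_step S a).
Proof.
have [hasl|nhas] := boolP (has (fun c => coef a c != 0) (lin S)).
  exact: resolves_step_pivot.
exact: resolves_step_combine.
Qed.

(** The functions of s are linear, nonzero on their own vectors, and vanish on
    the earlier vectors of s. *)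
Definition triangular_dual s :=
  {in s, forall c, scalar c.2 /\ c.2 c.1 != 0} /\
  pairwise (fun c l => l.2 c.1 == 0) s.

Lemma scalar_comb (f : 'cV[R]_n.+1 -> R) x y u v : scalar f ->
  f (x *: u - y *: v) = x * f u - y * f v.
Proof.
move=> fl; have f0 : f 0 = 0.
  by have := fl 1 0 0; rewrite scaler0 addr0 mul1r => ?; lra.
have fZ w r : f (r *: w) = r * f w by rewrite -[r *: w]addr0 fl f0 addr0.
by rewrite -scaleNr fl fZ mulNr.
Qed.

Lemma scalar_opp (f : 'cV[R]_n.+1 -> R) u : scalar f -> f (- u) = - f u.
Proof.
move=> fl; have := scalar_comb 0 1 u u fl.
by rewrite !scale0r !mul0r scale1r mul1r !sub0r.
Qed.

(** Pivoting only rescales the functions, and those after the pivot vanish on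
    it; hence subtracting multiples of the pivot preserves the duality. *)
Lemma triangular_dual_step a S :
  triangular_dual (lin S) -> triangular_dual (lin (dd_step S a)).
Proof.
have [hasl|nhas] := boolP (has (fun c => coef a c != 0) (lin S)); last first.
  by rewrite dd_stepE_combine.
have [before [l0 [after [l]]]] := dd_stepE_pivot hasl.
move=> [-> before0 l_pos l_l0 ->].
have al : coef a l != 0 by rewrite gt_eqF.
move=> [dual]; rewrite !pairwise_cat /=.
move=> /and3P[/allrelP before_after pb /andP[/allP l0_after pa]].
have dual_after c : c \in after -> scalar c.2 /\ c.2 c.1 != 0.
  by move=> ca; apply: dual; rewrite mem_cat inE ca !orbT.
have after_l c : c \in after -> c.2 l.1 = 0.
  move=> ca; have [cl _] := dual_after _ ca; have /eqP l0c := l0_after _ ca.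
  by case: l_l0 => ->; rewrite ?scalar_opp ?l0c ?oppr0.
have elimE c e : c \in after ->
    (eliminate a l c).2 (eliminate a l e).1 = c.2 e.1.
  move=> ca; have [cl _] := dual_after _ ca.
  by rewrite /= scalar_comb // after_l // mulr0 subr0 mulrAC divff // mul1r.
split.
  move=> c; rewrite mem_cat => /orP[cb|/mapP[e ea ->]].
    by apply: dual; rewrite mem_cat cb.
  have [el ee] := dual_after _ ea; split; last by rewrite elimE.
  by move=> x u v /=; rewrite el mulrDl mulrA.
rewrite pairwise_cat pb andTb; apply/andP; split.
  apply/allrelP => c _ cb /mapP[e ea ->] /=.
  have e_l0 : e \in l0 :: after by rewrite inE ea orbT.
  by have /eqP -> := before_after c e cb e_l0; rewrite mul0r.
rewrite pairwise_map.
apply: (sub_in_pairwise (P := mem after)) pa; last exact: allss.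
move=> c e ca ea /= /eqP ce; apply/eqP.
by rewrite -[LHS]/((eliminate a l e).2 (eliminate a l c).1) elimE.
Qed.

Lemma lin_neq0 s c : triangular_dual s -> c \in s -> c.1 <> 0.
Proof.
move=> [dual _] /dual [cl] /eqP c0 c10; apply: c0.
by rewrite c10; have := scalar_opp 0 cl; rewrite oppr0 => ?; lra.
Qed.

(** * Initial state and iteration *)

(** The coordinates on which the initial state imposes no sign. *)
Definition free_coord (rho : nat) (j : 'I_n.+1) := (0 < j <= rho)%N.

Lemma coef_delta (j : 'I_n.+1) z : (delta_mx (0 : 'I_1) j *m z) 0 0 = z j 0.
Proof. by rewrite -rowE mxE. Qed.

Lemma valid_init rho j : ~~ free_coord rho j ->
  valid (delta_mx 0 j) (dd_init rho : dd_state R n).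
Proof.
move=> jsign; split=> _ /mapP[k + ->]; rewrite mem_filter /coef coef_delta mxE.
  by rewrite ler0n.
case/andP => kfree _; have [jk|//] := eqVneq j k.
by move: jsign; rewrite jk /free_coord kfree.
Qed.

Lemma resolves_init rho z : (forall j, ~~ free_coord rho j -> 0 <= z j 0) ->
  resolves z (dd_init rho).
Proof.
move=> z0; split=> [_ /mapP[k + ->] /=|].
  by rewrite mem_filter => /andP[kfree _]; exact: z0.
rewrite /dd_init /= !big_map !big_filter !big_enum_cond /=.
transitivity (\sum_k z k 0 *: delta_mx k (0 : 'I_1)).
  by rewrite [RHS](bigID (free_coord rho)).
apply/matrixP => i j; rewrite summxE (bigD1 i) //= !mxE eqxx [j]ord1 mulr1.
by rewrite big1 ?addr0 // => k /negbTE ki; rewrite !mxE eq_sym ki mulr0.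
Qed.

Lemma triangular_dual_init rho :
  triangular_dual (lin (dd_init rho : dd_state R n)).
Proof.
split=> [_ /mapP[k _ ->] /=|].
  by split=> [x u v|]; rewrite !mxE ?eqxx ?oner_eq0.
rewrite pairwise_map; apply: (@sub_pairwise _ [rel i j | i != j]).
  by move=> i j /= ij; rewrite mxE [j == i]eq_sym (negbTE ij).
by rewrite -uniq_pairwise filter_uniq // enum_uniq.
Qed.

Lemma ddS m (B : 'M[R]_(m, n.+1)) rho (i : 'I_m) :
  dd B rho i.+1 = dd_step (dd B rho i) (row i B).
Proof.
have i_lt : (i < size (enum 'I_m))%N by rewrite size_enum_ord.
have i_lt' : (i < size [seq row i B | i <- enum 'I_m])%N by rewrite size_map.
rewrite /dd (take_nth (row i B) i_lt') foldl_rcons; congr dd_step.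
by rewrite (nth_map i _ _ i_lt) nth_ord_enum.
Qed.

(** Invariants of the method, indexed by the number of processed rows. *)
Lemma dd_ind m (B : 'M[R]_(m, n.+1)) rho (K : nat -> dd_state R n -> Prop) :
  K 0%N (dd_init rho) ->
  (forall (i : 'I_m) S, K i S -> K i.+1 (dd_step S (row i B))) ->
  forall k, (k <= m)%N -> K k (dd B rho k).
Proof.
move=> K0 KS; elim=> [_|k IH k_lt]; first by rewrite /dd take0.
by rewrite -[k]/(val (Ordinal k_lt)) ddS; apply/KS/IH/ltnW.
Qed.

(** * Conic hulls and dehomogenization *)

(** The nonnegative combinations of the vectors of s. *)
Definition conic_hull s : set 'cV[R]_n.+1 :=
  [set gen_mx s *m u | u in [set u : 'cV[R]_(size s) | forall i, 0 <= u i 0]].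

Lemma col_gen_mx s i : col i (gen_mx s) = (tnth (in_tuple s) i).1.
Proof. by apply/matrixP => j k; rewrite !mxE [k]ord1. Qed.

Lemma conic_hull_mem s c : c \in s -> conic_hull s c.1.
Proof.
move=> cs; have /tnthP[i ->] : c \in in_tuple s by [].
exists (delta_mx i 0); last by rewrite -colE col_gen_mx.
by move=> j; rewrite mxE ler0n.
Qed.

Lemma conic_hullZ s x z : 0 <= x -> conic_hull s z -> conic_hull s (x *: z).
Proof.
move=> x0 [u u0 <-]; exists (x *: u); last by rewrite -scalemxAr.
by move=> i; rewrite mxE mulr_ge0.
Qed.

Lemma conic_hullD s y z :
  conic_hull s y -> conic_hull s z -> conic_hull s (y + z).
Proof.
move=> [u u0 <-] [v v0 <-]; exists (u + v); last by rewrite mulmxDr.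
by move=> i; rewrite mxE addr_ge0.
Qed.

Lemma gen_mx_conic s s' : {in s', forall c, conic_hull s c.1} ->
  exists2 M : 'M[R]_(size s, size s'), (forall i j, 0 <= M i j) &
    gen_mx s' = gen_mx s *m M.
Proof.
move=> ss'.
have /choice[u uP] (j : 'I_(size s')) : exists u : 'cV[R]_(size s),
    (forall i, 0 <= u i 0) /\ gen_mx s *m u = col j (gen_mx s').
  rewrite col_gen_mx; have [u u0 uE] := ss' _ (mem_tnth j (in_tuple s')).
  by exists u.
exists (\matrix_(i, j) u j i 0) => [i j|]; first by rewrite mxE; case: (uP j).
apply/matrixP => i j; have [_ /matrixP/(_ i 0)] := uP j.
by rewrite !mxE => <-; apply: eq_bigr => k _; rewrite !mxE.
Qed.

Lemma dehomogenizeP s c : c \in dehomogenize s ->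
  exists2 e, e \in s & exists2 x, 0 < x & c.1 = x *: e.1.
Proof.
move=> /mapP[e es ->]; exists e => //; case: ifP => [e0|_].
  by exists (e.1 0 0)^-1; rewrite ?invr_gt0.
by exists 1; rewrite ?scale1r.
Qed.

Lemma conic_hull_dehomogenize s e : e \in s -> conic_hull (dehomogenize s) e.1.
Proof.
move=> es; pose c : gen R n := if 0 < e.1 0 0
  then ((e.1 0 0)^-1 *: e.1, fun z => e.1 0 0 * e.2 z) else e.
have cs : c \in dehomogenize s by apply/mapP; exists e.
have := conic_hull_mem cs; rewrite /c; case: ifP => //= e0.
by move/(conic_hullZ (ltW e0)); rewrite scalerA divff ?scale1r // gt_eqF.
Qed.

Lemma dehomogenize_step_conic a S : lin S = [::] ->
  {in dehomogenize (ray (dd_step S a)), forall c,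
    conic_hull (dehomogenize (ray S)) c.1}.
Proof.
move=> lS c /dehomogenizeP[e eS [x x0 ->]].
apply: conic_hullZ; first exact: ltW.
have nhas : ~~ has (fun c => coef a c != 0) (lin S) by rewrite lS.
case/(ray_combineP nhas): eS =>
    [[c' [c'S _] ->]|[c1 [c2 [[c1S c1p] [c2S c2n] ->]]]].
  exact: conic_hull_dehomogenize.
apply: conic_hullD; first exact/(conic_hullZ (ltW c1p))/conic_hull_dehomogenize.
rewrite -scaleNr; apply: conic_hullZ; first by rewrite oppr_ge0 ltW.
exact: conic_hull_dehomogenize.
Qed.

Lemma gen_mx_mu s (x : 'cV[R]_n) :
  gen_mx s *m gen_mu s x = \sum_(c <- s) c.2 (homog x) *: c.1.
Proof.
rewrite big_tnth; apply/matrixP => i j; rewrite mxE summxE.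
by apply: eq_bigr => k _; rewrite !mxE [j]ord1 mulrC.
Qed.

(** Dehomogenization rescales a ray and its function inversely, so their product
    does not change. *)
Lemma dehomogenize_resolves S (x : 'cV[R]_n) : lin S = [::] ->
  resolves (homog x) S ->
  (forall i, 0 <= gen_mu (dehomogenize (ray S)) x i 0) /\
  gen_mx (dehomogenize (ray S)) *m gen_mu (dehomogenize (ray S)) x = homog x.
Proof.
move=> lS [mu0]; rewrite lS big_nil add0r => xE; split.
  move=> i; rewrite mxE; have := mem_tnth i (in_tuple (dehomogenize (ray S))).
  case/mapP => c cS ->; case: ifP => [c0|_]; last exact: mu0.
  by rewrite mulr_ge0 ?mu0 ?ltW.
rewrite gen_mx_mu -[RHS]xE big_map; apply: eq_bigr => c _; case: ifP => //= c0.
by rewrite scalerA mulrAC divff ?mul1r // gt_eqF.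
Qed.

End DoubleDescription.

(** * Homogenization of a polytope *)

Section Polytope.
Context {R : realType} {m n : nat} (A : 'M[R]_(m, n)) (b : 'cV[R]_m).

(** The part x of (x_0; x). *)
Definition tail (z : 'cV[R]_n.+1) : 'cV[R]_n := \col_i z (lift ord0 i) 0.

Lemma homog_tail (z : 'cV[R]_n.+1) : z 0 0 = 1 -> homog (tail z) = z.
Proof.
move=> z0; apply/matrixP => i j; rewrite [j]ord1.
case: (unliftP ord0 i) => [k ->|->].
  by rewrite homog_lift mxE.
by rewrite homog0.
Qed.

Lemma tail_homog x : tail (homog x) = x :> 'cV[R]_n.
Proof. by apply/matrixP => i j; rewrite mxE homog_lift [j]ord1. Qed.

Lemma row_homog_system i (z : 'cV[R]_n.+1) :
  (row i (row_mx b (- A)) *m z) 0 0 = b i 0 * z 0 0 - (A *m tail z) i 0.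
Proof.
rewrite -row_mul !mxE big_ord_recl; congr (_ * _ + _).
  by rewrite mxE; case: splitP => // k _; rewrite [k]ord1.
rewrite -sumrN; apply: eq_bigr => j _.
have -> : row_mx b (- A) i (lift ord0 j) = (- A) i j.
  by have -> : lift ord0 j = rshift 1 j; [exact: val_inj|exact: row_mxEr].
by rewrite !mxE mulNr.
Qed.

(** A nonempty bounded polyhedron has no nonzero recession direction. *)
Lemma bounded_polyhedron_recession (u : 'cV[R]_n) :
  polyhedron A b !=set0 -> bounded_set (polyhedron A b) ->
  (forall i, (A *m u) i 0 <= 0) -> u = 0.
Proof.
move=> [x Px] [M [_ PM]] Au.
have {}PM y : polyhedron A b y -> `|y| <= M + 1.
  by move=> Py; apply: (PM (M + 1)) => //; rewrite ltrDl.
apply/eqP; rewrite -normr_eq0; apply: contrapT => /negP u0.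
have {u0}u_pos : 0 < `|u| by rewrite lt_neqAle eq_sym u0 normr_ge0.
(* Far enough along u to leave the ball of radius M + 1. *)
pose t := (M + 2 + `|x|) / `|u|.
have M0 : 0 <= M + 1 by apply: le_trans (PM _ Px).
have t0 : 0 <= t.
  by apply: divr_ge0 => //; have := normr_ge0 x; lra.
have /PM le_M : polyhedron A b (x + t *: u).
  move=> i; rewrite mulmxDr -scalemxAr !mxE -[leRHS]addr0 lerD //.
    by have := Px i; rewrite mxE.
  by have := Au i; rewrite mxE => ?; rewrite mulr_ge0_le0.
have : `|t *: u| <= M + 1 + `|x|.
  by rewrite -[t *: u](addKr x) addrC (le_trans (ler_normB _ _)) // lerD2r.
by rewrite normrZ (ger0_norm t0) divfK ?gt_eqF //; lra.
Qed.

End Polytope.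

(** * The hierarchy of relaxations *)

Theorem theorem2 (R : realType) (m n d : nat)
    (A : 'M[R]_(m, n)) (b : 'cV[R]_m)
    (C : set 'cV[R]_d) (g : 'I_n.+1 -> 'cV[R]_d -> R) (rho : nat)
    (C_nonempty : C !=set0) (C_compact : compact C)
    (C_convex : @convex_set R 'cV[R]_d C)
    (P_nonempty : polyhedron A b !=set0)
    (P_bounded : bounded_set (polyhedron A b))
    (g_convex : forall j, @convex_function R 'cV[R]_d setT (g j))
    (rho_le_n : (rho <= n)%N)
    (g_affine : forall j : 'I_n.+1, (0 < j <= rho)%N -> affine (g j))
    (P_nonneg : forall x, polyhedron A b x ->
       forall i : 'I_n, (rho < i.+1)%N -> 0 <= x i 0) :
  let S k := dd (row_mx b (- A)) rho k in
  let G k := dehomogenize (ray (S k)) in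
  let Q := ac_problem g C (polyhedron A b) in
  let QD k := acd_problem g C (gen_mx (G k)) (gen_mu (G k)) in
  let QDbar k := acd_lifted_problem g C (gen_mx (G k)) in
  exists kbar : nat,
    [/\ (kbar <= m)%N,
        lin (S kbar) = [::] /\ (forall k, (k < kbar)%N -> lin (S k) <> [::]),
        forall k, (kbar <= k <= m)%N ->
          [/\ relaxes (QD k) Q,
              convex_problem (QDbar k) &
              relaxes (QDbar k) (QD k)],
        forall k, (kbar <= k < m)%N -> (opt_value (QDbar k) <= opt_value (QDbar k.+1))%E &
        opt_value (QDbar m) = opt_value Q].
Proof.
move=> S G Q QD QDbar.
pose B : 'M[R]_(m, n.+1) := row_mx b (- A).
(* Every state satisfies the inequalities that produced it. *)
have valid_coord k j : (k <= m)%N -> ~~ free_coord rho j ->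
    valid (delta_mx 0 j) (S k).
  move=> km jsign; apply: (dd_ind (K := fun=> valid (delta_mx 0 j))) km.
    exact: valid_init.
  by move=> i T; exact: valid_step.
have valid_row i : valid (row i B) (S m).
  apply: (dd_ind (K := fun k T => (i < k)%N -> valid (row i B) T))
    (ltn_ord i) => //.
  move=> k T IH; rewrite ltnS leq_eqVlt => /orP[/eqP/val_inj ->|/IH].
    exact: valid_step_new.
  exact: valid_step.
have resolves_P k x :
    (k <= m)%N -> polyhedron A b x -> resolves (homog x) (S k).
  move=> km Px; apply: (dd_ind (K := fun=> resolves (homog x))) km.
    apply: resolves_init => j; case: (unliftP ord0 j) => [i ->|-> _].
      by rewrite homog_lift /free_coord /= -ltnNge; exact: P_nonneg.
    by rewrite homog0.
  move=> i T; apply: resolves_step.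
  by rewrite row_homog_system homog0 mulr1 tail_homog subr_ge0.
have dual k : (k <= m)%N -> triangular_dual (lin (S k)).
  move=> km; apply: (dd_ind (K := fun=> (fun T => triangular_dual (lin T)))) km.
    exact: triangular_dual_init.
  by move=> i T; exact: triangular_dual_step.
(* No nonzero solution of the homogenized system lies at infinity. *)
have recession (z : 'cV[R]_n.+1) :
    z 0 0 = 0 -> (forall i, 0 <= (row i B *m z) 0 0) -> z = 0.
  move=> z0 Bz; have tail0 : tail z = 0.
    apply: (bounded_polyhedron_recession P_nonempty P_bounded) => i.
    by have := Bz i; rewrite row_homog_system z0 mulr0 sub0r oppr_ge0.
  apply/matrixP => i j; rewrite [j]ord1 mxE.
  case: (unliftP ord0 i) => [k ->|-> //].
  by move/matrixP: tail0 => /(_ k 0); rewrite !mxE.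
have lin_m : nilp (lin (S m)).
  case linE: (lin (S m)) => [//|c s].
  have c_lin : c \in lin (S m) by rewrite linE mem_head.
  case: (lin_neq0 (dual _ (leqnn m)) c_lin); apply: recession => [|i].
    by rewrite -coef_delta; apply: (valid_coord m 0 _ _).2.
  by have -> : (row i B *m c.1) 0 0 = 0 by exact: (valid_row i).2.
have lin_exists : exists k, nilp (lin (S k)) by exists m.
case: (ex_minnP lin_exists) => kbar /nilP lin_kbar kbar_min.
have lin_nil k : (kbar <= k <= m)%N -> lin (S k) = [::].
  case/andP; elim: k => [|k IH]; first by rewrite leqn0 => /eqP <-.
  rewrite leq_eqVlt => /orP[/eqP <- //|kbar_k] k_lt.
  have lin_k := IH kbar_k (ltnW k_lt).
  rewrite /S -[k]/(val (Ordinal k_lt)) ddS dd_stepE_combine /= -/(S k) lin_k //.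
have dir k : (k <= m)%N ->
    forall i, sublinear_direction g (col i (gen_mx (G k))).
  move=> km i j; have [|jsign] := boolP (free_coord rho j).
    by left; exact: g_affine.
  right; split=> //; rewrite col_gen_mx.
  have /dehomogenizeP[e eS [x x0 ->]] := mem_tnth i (in_tuple (G k)).
  have := (valid_coord k j km jsign).1 e eS; rewrite /coef coef_delta => e_j.
  by rewrite mxE mulr_ge0 // ltW.
have lifted_ge k : (k <= m)%N -> relaxes (QDbar k) (QD k).
  by move=> km; exact: lifted_relaxes_acd.
have QD_relaxes k : (kbar <= k <= m)%N -> relaxes (QD k) Q.
  move=> kk; apply: acd_relaxes_ac => x Px.
  case/andP: (kk) => _ km.
  exact: (dehomogenize_resolves (lin_nil _ kk) (resolves_P _ _ km Px)).
exists kbar; split.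
- exact: kbar_min.
- split=> // k k_lt lin_k.
  have := kbar_min k; rewrite /nilp lin_k /= => /(_ isT).
  by rewrite leqNgt k_lt.
- move=> k kk; case/andP: (kk) => _ km.
  split; [exact: QD_relaxes| |exact: lifted_ge].
  by apply: lifted_convex => //; exact: dir.
- move=> k /andP[kbar_k k_lt]; apply: opt_value_relaxes.
  have lin_k := lin_nil k; rewrite kbar_k (ltnW k_lt) in lin_k.
  have [M M0 ME] : exists2 M : 'M[R]_(size (G k), size (G k.+1)),
      (forall i j, 0 <= M i j) & gen_mx (G k.+1) = gen_mx (G k) *m M.
    apply: gen_mx_conic.
    rewrite /G /S -[k.+1]/((val (Ordinal k_lt)).+1) ddS.
    exact: dehomogenize_step_conic (lin_k isT).
  rewrite /QDbar ME; apply: lifted_relaxes => //; exact: dir (ltnW k_lt).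
apply/le_anti/andP; split; apply: opt_value_relaxes.
  have mm : (kbar <= m <= m)%N by rewrite kbar_min ?leqnn.
  move=> v Qv; have [w QDw wv] := QD_relaxes m mm v Qv.
  have [u Qu uw] := lifted_ge m (leqnn m) w QDw.
  by exists u => //; exact: le_trans wv.
(* With all rows processed, each generator is zero or a point of P. *)
apply: ac_relaxes_lifted => i; rewrite col_gen_mx.
move: (tnth _ _) (mem_tnth i (in_tuple (G m))) => _ /mapP[c cS ->].
have cB j : 0 <= (row j B *m c.1) 0 0 by exact: (valid_row j).1.
have : 0 <= c.1 0 0 by rewrite -coef_delta; apply: (valid_coord m 0 _ _).1.
rewrite le_eqVlt => /orP[/eqP c0|c0].
  by left; rewrite -c0 ltxx; exact: recession.
right; rewrite c0 /=; have v0 : ((c.1 0 0)^-1 *: c.1) 0 0 = 1.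
  by rewrite mxE mulVf // gt_eqF.
exists (tail ((c.1 0 0)^-1 *: c.1)); last by rewrite homog_tail.
move=> j; rewrite -subr_ge0 -[b j 0]mulr1 -v0 -row_homog_system -scalemxAr mxE.
by rewrite mulr_ge0 // invr_ge0 ltW.
Qed.
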